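(* Let $N\in\mathbb{Z}_+$, $\bar a_k,\bar b_k\in\mathbb{R}$, $q_k,r_k,\bar q_k,\bar r_k>0$ for $k\in\{0,\dots,N-1\}$, and $q_N,\bar q_N>0$. Let $(\epsilon_k)_k$ be a zero-mean real random process with $\epsilon_0=0$, and let $x_0$ be a given real random variable independent of $\epsilon$. Consider the problem of minimizing $\mathbb{E}[L(x_0,u)]$, where $$L(x_0,u)=q_N\,\mathrm{var}(x_N)+\bar q_N\bar x_N^4+\sum_{k=0}^{N-1}\left(q_k\,\mathrm{var}(x_k)+\bar q_k\bar x_k^4+r_k\,\mathrm{var}(u_k)+\bar r_k\bar u_k^4\right),$$ over admissible controls $u=(u_k)_{k\in\{0,\dots,N-1\}}$, subject to $$x_{k+1}=\bar a_kx_k+\bar b_ku_k+\epsilon_{k+1},\qquad k\in\{0,\dots,N-1\}.$$ Then the optimal control input is $$u_k^*=-\frac{\alpha_{k+1}\bar b_k\bar a_k}{r_k+\alpha_{k+1}\bar b_k^2}(x_k-\bar x_k)-\frac{\left(\frac{\bar\alpha_{k+1}\bar b_k}{\bar r_k}\right)^{1/3}\bar a_k}{1+\left(\frac{\bar\alpha_{k+1}\bar b_k}{\bar r_k}\right)^{1/3}\bar b_k}\,\bar x_k,$$ where $\bar\alpha,\bar\gamma,\alpha$ solve, for $k\in\{0,\dots,N-1\}$, the recursive equations $$\bar\alpha_k=\bar q_k+\bar r_k\left(\frac{\left(\frac{\bar\alpha_{k+1}\bar b_k}{\bar r_k}\right)^{1/3}\bar a_k}{1+\left(\frac{\bar\alpha_{k+1}\bar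 b_k}{\bar r_k}\right)^{1/3}\bar b_k}\right)^4+\bar\alpha_{k+1}\left(\bar a_k-\frac{\left(\frac{\bar\alpha_{k+1}\bar b_k}{\bar r_k}\right)^{1/3}\bar a_k\bar b_k}{1+\left(\frac{\bar\alpha_{k+1}\bar b_k}{\bar r_k}\right)^{1/3}\bar b_k}\right)^4,$$ $$\bar\gamma_k=\bar\gamma_{k+1}+\alpha_{k+1}\mathbb{E}(\epsilon_{k+1}^2),$$ $$\alpha_k=q_k+r_k\left(\frac{\alpha_{k+1}\bar b_k\bar a_k}{r_k+\alpha_{k+1}\bar b_k^2}\right)^2+\alpha_{k+1}\left(\bar a_k-\frac{\alpha_{k+1}\bar b_k^2\bar a_k}{r_k+\alpha_{k+1}\bar b_k^2}\right)^2,$$ with $\bar\alpha_N=\bar q_N$, $\bar\gamma_N=0$, $\alpha_N=q_N$.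
   Context: Notation: $\bar x_k=\mathbb{E}[x_k]$, $\bar u_k=\mathbb{E}[u_k]$, $\mathrm{var}(x)=\mathbb{E}[(x-\bar x)^2]$, $\mathrm{var}(u)=\mathbb{E}[(u-\bar u)^2]$. $(\cdot)^{1/3}$ is the real cube root. Moments appearing in the recursions are understood to be finite real numbers. Admissible controls are sequences $(u_k)_{k\in\{0,\dots,N-1\}}$ of real-valued Lebesgue measurable controls with $\bar u_k^4<+\infty$, in state-feedback form: $u_k$ is a function of the current state $x_k$ that may also depend on the distribution of $x_k$ (for instance through $\bar x_k$). ''Optimal'' means attaining the minimum of the expected cost over admissible controls.
   Formalization: Added: the noise has zero conditional mean given its own past, E[ε_{k+1} | ε_0,…,ε_k] = 0 (e.g. independent in time); with only zero means the claim fails (N=2, x_0=0, ε_1=ε_2=±1). x_0 is taken integrable so that its mean exists. *)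

(* Defs.v *)
From HB Require Import structures.
From mathcomp Require Import all_boot all_order all_algebra.
From mathcomp Require Import all_classical all_reals all_analysis.
(* The sum of measurable functions as a measurable function is in this file,
   which all_analysis does not export. *)
From mathcomp Require Import measurable_realfun.

Set Implicit Arguments.
Unset Strict Implicit.
Unset Printing Implicit Defensive.

Import Order.TTheory GRing.Theory Num.Theory.

Local Open Scope classical_set_scope.
Local Open Scope ring_scope.

(* Real cube root: odd, so it is defined on negative reals as well, unlike
   the power function [powR]. *)
Definition cbrt (R : realType) (x : R) : R := Num.sg x * (`|x| `^ 3%:R^-1).

Lemma cbrtK (R : realType) (x : R) : cbrt x ^+ 3 = x.
Proof.
have E : (`|x| `^ 3%:R^-1) ^+ 3 = `|x|.
  by rewrite -powR_mulrn ?powR_ge0// -powRrM mulVf ?pnatr_eq0// powRr1.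
rewrite /cbrt exprMn E [Num.sg x ^+ 3]exprS mulrAC -numEsg.
by have [->|x0] := eqVneq x 0; rewrite ?mul0r// sqr_sg x0 mulr1.
Qed.

(* A feedback law gives, at each stage k, a measurable function of the current
   state, which may also depend on the probability law of that state. *)
Definition policy (R : realType) : Type :=
  nat -> probability R R -> {mfun R >-> R}.

Section problem.
Context d (T : measurableType d) (R : realType) (P : probability T R).
Implicit Types (phi psi : policy R) (eps : nat -> {RV P >-> R}).

Definition feedback phi (k : nat) (x : {RV P >-> R}) : {RV P >-> R} :=
  (phi k (distribution P x) \o x : {mfun T >-> R}).

Fixpoint state (a b : nat -> R) (x0 : {RV P >-> R}) eps phi
    (k : nat) : {RV P >-> R} :=
  if k is j.+1 then
    let x := state a b x0 eps phi j in
    (a j \o* x) \+ (b j \o* feedback phi j x) \+ eps j.+1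
      : {mfun T >-> R}
  else x0.

Definition control (a b : nat -> R) (x0 : {RV P >-> R}) eps phi
    (k : nat) : {RV P >-> R} :=
  feedback phi k (state a b x0 eps phi k).

Lemma stateS (a b : nat -> R) (x0 : {RV P >-> R}) eps phi (k : nat) (w : T) :
  state a b x0 eps phi k.+1 w =
    a k * state a b x0 eps phi k w + b k * control a b x0 eps phi k w
    + eps k.+1 w.
Proof. by rewrite [a k * _]mulrC [b k * _]mulrC. Qed.

(* In the extended reals 'E_P[u] is finite if and only if u is integrable; this
   is how the requirement that 'E_P[u_k] ^+ 4 be finite is read. *)
Definition admissible (N : nat) (a b : nat -> R)
    (x0 : {RV P >-> R}) eps phi : Prop :=
  forall k, (k < N)%N ->
    P.-integrable setT (EFin \o control a b x0 eps phi k).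

(* The variances and means are deterministic, so L(x_0, u) is a constant equal
   to its own expectation. For an admissible control and an integrable x0 all
   the means are finite, but a variance may be +oo. *)
Definition cost (N : nat) (a b q r qbar rbar : nat -> R)
    (x0 : {RV P >-> R}) eps phi : \bar R :=
  let x := state a b x0 eps phi in
  let u := control a b x0 eps phi in
  ((q N)%:E * 'V_P[x N] + (qbar N)%:E * 'E_P[x N] ^+ 4 +
   \sum_(k < N) ((q k)%:E * 'V_P[x k] + (qbar k)%:E * 'E_P[x k] ^+ 4 +
                 (r k)%:E * 'V_P[u k] + (rbar k)%:E * 'E_P[u k] ^+ 4))%E.

Definition optimal (N : nat) (a b q r qbar rbar : nat -> R)
    (x0 : {RV P >-> R}) eps phi : Prop :=
  admissible N a b x0 eps phi /\
  forall psi, admissible N a b x0 eps psi ->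
    (cost N a b q r qbar rbar x0 eps phi <=
     cost N a b q r qbar rbar x0 eps psi)%E.

(* Independence of x0 from the whole process eps_0, ..., eps_N, that is, of the
   sigma-algebras they generate. *)
Definition independent_of_process (N : nat) (x0 : {RV P >-> R}) eps : Prop :=
  forall A B : set T,
    preimage_set_system setT x0 measurable A ->
    g_sigma_preimage (fun i : 'I_N.+1 => eps i : T -> R) B ->
    (P (A `&` B) = P A * P B)%E.

(* E[eps_(k+1) | eps_0, ..., eps_k] = 0 for k < N: the noise has zero mean at
   each stage given its own past. For a noise independent in time this is the
   vanishing of the means. It cannot be dropped: for a noise such as
   eps_2 = eps_1, observing the state helps to predict the next disturbance, and
   a feedback using that prediction does better. *)
Definition zero_mean_given_past (N : nat) eps : Prop :=
  forall k, (k < N)%N -> forall A : set T,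
    g_sigma_preimage (fun i : 'I_k.+1 => eps i : T -> R) A ->
    (\int[P]_(w in A) (eps k.+1 w)%:E = 0)%E.

End problem.

(* Main.v *)
Require Import Defs.
From HB Require Import structures.
From mathcomp Require Import all_boot all_order all_algebra.
From mathcomp Require Import all_classical all_reals all_analysis.
From mathcomp Require Import measurable_realfun.
From mathcomp Require Import ring.

Set Implicit Arguments.
Unset Strict Implicit.
Unset Printing Implicit Defensive.

Import Order.TTheory GRing.Theory Num.Theory.

Local Open Scope classical_set_scope.
Local Open Scope ring_scope.

(** The variance and the mean of the state evolve separately.  Writing m, v for
    the mean and variance of x_k, n, w for those of u_k and z for the covariance
    of x_k and u_k, the dynamics give
      m' = a m + b n,    v' = a^2 v + 2 a b z + b^2 w + E(eps_{k+1}^2),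
    the second one because the noise is orthogonal to every function of the
    current state.  The cost only depends on these moments, and the problem is
    solved by the value function
      J_k = alpha_k v + alphabar_k m^4 + gammabar_k.
    Telescoping J along any policy with finite cost ([cost_gap]) gives
      cost = J_0 + sum_k gap_k,
    where J_0 depends on x_0 alone and gap_k, the amount by which the stage cost
    plus J_{k+1} exceeds J_k, splits into a variance part and a mean part
    ([gapE]).

    The variance part is (r + alpha b^2) times the variance of u_k + K x_k, with
    alpha and alphabar taken at k+1 and K the variance gain ([variance_stage]).  The mean
    part compares the convex function n |-> rbar n^4 + alphabar (a m + b n)^4 with
    its minimum ([mean_stage]): a critical point satisfies
    rbar n^3 = - alphabar b (a m + b n)^3, which becomes linear after taking cube
    roots, and this is where the cube root in the feedback law comes from.  Both
    parts are nonnegative ([gap_ge0]) and vanish for the announced feedback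
    ([gap_feedback_law]), which is therefore optimal among the policies of finite
    cost.  A policy of finite cost has square integrable states and controls
    ([square_integrable_of_cost_lty]), so the moments above make sense for it;
    the remaining policies cost +oo and there is nothing to compare.

    The probabilistic core is the orthogonality of the noise and the state.  The
    state x_k is measurable for the sigma-algebra generated by x_0 and
    eps_0, ..., eps_k; the integral of eps_{k+1} over the intersection of an event
    of x_0 and an event of eps_0, ..., eps_k vanishes by independence and by the
    assumption on the noise given its past, hence over every event of that
    sigma-algebra by the pi-lambda theorem ([integral_past]); approximation by
    simple functions then gives orthogonality to all square integrable functions
    of the state ([integral_mul_eq0], [covariance_noise]). *)

(** * Scalar inequalities for one stage *)

(** The fourth power lies above its tangents: the difference factors as
    (x - y)^2 ((x + y)^2 + 2 y^2). *)
Lemma quartic_tangent (R : realDomainType) (x y : R) :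
  y ^+ 4 + 4 * y ^+ 3 * (x - y) <= x ^+ 4.
Proof.
rewrite -subr_ge0.
suff -> : x ^+ 4 - (y ^+ 4 + 4 * y ^+ 3 * (x - y)) =
    (x - y) ^+ 2 * ((x + y) ^+ 2 + 2 * y ^+ 2).
  by rewrite mulr_ge0 ?sqr_ge0// addr_ge0 ?sqr_ge0// mulr_ge0 ?sqr_ge0// ler0n.
by ring.
Qed.

Lemma cbrt_mul_ge0 (R : realType) (c x : R) : 0 <= c -> 0 <= cbrt (c * x) * x.
Proof.
move=> c0; rewrite /cbrt sgrM mulrAC mulr_ge0 ?powR_ge0//.
by rewrite -mulrA -normrEsg mulr_ge0// sgr_ge0.
Qed.

Lemma mean_gain_denom_gt0 (R : realType) (p r b : R) : 0 < p -> 0 < r ->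
  0 < 1 + cbrt (p * b / r) * b.
Proof.
move=> p0 r0; rewrite ltr_wpDr// [p * b / r]mulrAC cbrt_mul_ge0// divr_ge0 ?ltW//.
Qed.

(** Both quartics are bounded below by their tangents at the candidate minimizer
    n' = - K m and at y = a m + b n'.  The first-order terms cancel there, because
    n' = - c y and c^3 = p b / r; the zeroth-order terms are the left-hand side. *)
Lemma mean_stage (R : realType) (p r a b m n : R)
    (c := cbrt (p * b / r)) (K := c * a / (1 + c * b)) : 0 < p -> 0 < r ->
  (r * K ^+ 4 + p * (a - c * a * b / (1 + c * b)) ^+ 4) * m ^+ 4
    <= r * n ^+ 4 + p * (a * m + b * n) ^+ 4.
Proof.
move=> p0 r0.
have c3 : c ^+ 3 = p * b / r by exact: cbrtK.
have D0 : 1 + c * b != 0 by rewrite gt_eqF// mean_gain_denom_gt0.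
have -> : c * a * b / (1 + c * b) = K * b by rewrite /K; field.
pose n' := - K * m; pose y := a * m + b * n'.
have ny : n' = - c * y by rewrite /n' /y /n' /K; field.
have crit : r * n' ^+ 3 + p * b * y ^+ 3 = 0.
  rewrite ny exprMn exprNn c3; field; exact: lt0r_neq0.
have tn := ler_wpM2l (ltW r0) (quartic_tangent n n').
have ty := ler_wpM2l (ltW p0) (quartic_tangent (a * m + b * n) y).
apply: le_trans (lerD tn ty).
have -> : r * (n' ^+ 4 + 4 * n' ^+ 3 * (n - n'))
    + p * (y ^+ 4 + 4 * y ^+ 3 * (a * m + b * n - y)) =
    r * n' ^+ 4 + p * y ^+ 4
    + 4 * (n - n') * (r * n' ^+ 3 + p * b * y ^+ 3) by rewrite /y; ring.
rewrite crit mulr0 addr0 le_eqVlt; apply/orP; left; apply/eqP.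
by rewrite /y /n'; ring.
Qed.

(** Completing the square: the difference of the two sides is
    (r + p b^2) (w + 2 K z + K^2 v).  For the variances v of x and w of u
    and their covariance z, w + 2 t z + t^2 v is the variance of u + t x. *)
Lemma variance_stage (R : realType) (p r a b v w z : R)
    (K := p * b * a / (r + p * b ^+ 2)) : 0 < p -> 0 < r ->
  (forall t, 0 <= w + 2 * t * z + t ^+ 2 * v) ->
  (r * K ^+ 2 + p * (a - p * b ^+ 2 * a / (r + p * b ^+ 2)) ^+ 2) * v
    <= r * w + p * (a ^+ 2 * v + 2 * (a * b * z) + b ^+ 2 * w).
Proof.
move=> p0 r0 wz.
have D0 : 0 < r + p * b ^+ 2.
  by rewrite ltr_wpDr// mulr_ge0 ?sqr_ge0// ltW.
rewrite -subr_ge0.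
suff -> : r * w + p * (a ^+ 2 * v + 2 * (a * b * z) + b ^+ 2 * w) -
   (r * K ^+ 2 + p * (a - p * b ^+ 2 * a / (r + p * b ^+ 2)) ^+ 2) * v =
   (r + p * b ^+ 2) * (w + 2 * K * z + K ^+ 2 * v).
  by rewrite mulr_ge0 ?wz// ltW.
by rewrite /K; field; exact: lt0r_neq0.
Qed.

(** * Functions orthogonal to the events of a random variable *)

Section orthogonality.
Context d (T : measurableType d) (R : realType) (P : probability T R).
Import HBNNSimple.

Lemma integral_nnsfun_comp_mul (g : {nnsfun R >-> R}) (f e : T -> R) :
  measurable_fun setT f -> P.-integrable setT (EFin \o e) ->
  (forall B, measurable B -> (\int[P]_(w in f @^-1` B) (e w)%:E = 0)%E) ->
  (\int[P]_w (g (f w) * e w)%:E = 0)%E.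
Proof.
move=> mf ie fe0.
have mpre y : measurable (f @^-1` (g @^-1` [set y])).
  by rewrite -[X in measurable X]setTI; apply: mf => //; exact: measurable_sfunP.
have indE y : (fun w => (y * \1_(g @^-1` [set y]) (f w) * e w)%:E) =
    (fun w => y%:E * ((EFin \o e) \_ (f @^-1` (g @^-1` [set y]))) w)%E.
  apply/funext => w; rewrite patchE.
  have -> : (w \in f @^-1` (g @^-1` [set y])) = (f w \in g @^-1` [set y]).
    by apply/idP/idP; rewrite !inE.
  rewrite indicE; case: (_ \in _); last by rewrite mulr0 mul0r mule0.
  by rewrite mulr1.
have iE y : P.-integrable setT ((EFin \o e) \_ (f @^-1` (g @^-1` [set y]))).
  apply/(integrable_mkcond _ (mpre y)); exact: (integrableS measurableT).
transitivity (\int[P]_w (\sum_(y <- finmap.enum_fset (fset_set (range g)))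
    (y * \1_(g @^-1` [set y]) (f w) * e w)%:E))%E.
  apply: eq_integral => w _.
  by rewrite fimfunE fsbig_finite//= mulr_suml sumEFin.
rewrite integral_sum//; last first.
  by move=> y; rewrite indE; exact: integrableZl.
rewrite big1// => y _.
rewrite indE integralZl// -integral_mkcond/= fe0 ?mule0//.
Qed.

(** The approximations are simple functions on the line composed with f, so that
    their level sets are events of f; domination by |f e| lets the limit pass. *)
Lemma integral_mul_ge0_eq0 (f e : T -> R) : (forall w, 0 <= f w) ->
  measurable_fun setT f -> P.-integrable setT (EFin \o e) ->
  P.-integrable setT (EFin \o (f \* e)) ->
  (forall B, measurable B -> (\int[P]_(w in f @^-1` B) (e w)%:E = 0)%E) ->
  (\int[P]_w (f w * e w)%:E = 0)%E.
Proof.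
move=> f0 mf ie ife fe0.
have mpos : measurable_fun setT (fun y : R => (Num.max y 0)%:E).
  by apply/measurable_EFinP; exact: measurable_maxr.
have pos0 (y : R) : setT y -> (0 <= (Num.max y 0)%:E)%E.
  by move=> _; rewrite lee_fin le_max lexx orbT.
pose g := nnsfun_approx measurableT mpos.
have me : measurable_fun setT e by apply/measurable_EFinP/(measurable_int P).
have [] := @dominated_convergence _ _ _ P setT measurableT
  (fun n w => (g n (f w) * e w)%:E) (EFin \o (f \* e))
  (abse \o (EFin \o (f \* e))).
- move=> n; apply/measurable_EFinP/measurable_funM => //.
  exact: measurableT_comp.
- exact: measurable_int ife.
- apply: aeW => w _.
  rewrite (_ : (_ \o _) w = (f w)%:E * (e w)%:E)%E//.
  under eq_fun do rewrite EFinM.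
  apply: cvgeMr => //.
  have -> : (f w)%:E = (Num.max (f w) 0)%:E by rewrite max_l.
  exact: cvg_nnsfun_approx.
- exact: integrable_abse.
- apply: aeW => w n _ /=; rewrite lee_fin !normrM ler_wpM2r//.
  rewrite !ger0_norm// -lee_fin.
  have -> : (f w)%:E = (Num.max (f w) 0)%:E by rewrite max_l.
  by rewrite nnsfun_approxE; exact: le_approx.
move=> _ _.
rewrite (_ : [sequence _]_n = cst 0%E); last first.
  apply/funext => n /=; exact: integral_nnsfun_comp_mul.
by move/cvg_lim => <- //; rewrite lim_cst.
Qed.

(** A variable e whose integral vanishes on all events of f has E(e | f) = 0,
    hence is orthogonal to f; here e is signed and f need not be bounded, so f is
    split into its positive and negative parts. *)
Lemma integral_mul_eq0 (f e : T -> R) :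
  measurable_fun setT f -> P.-integrable setT (EFin \o e) ->
  P.-integrable setT (EFin \o (f \* e)) ->
  (forall B, measurable B -> (\int[P]_(w in f @^-1` B) (e w)%:E = 0)%E) ->
  (\int[P]_w (f w * e w)%:E = 0)%E.
Proof.
move=> mf ie ife fe0.
have me : measurable_fun setT e by apply/measurable_EFinP/(measurable_int P).
have part (h : R -> R) : measurable_fun setT h -> (forall y, 0 <= h y) ->
    (forall y, h y <= `|y|) ->
    P.-integrable setT (fun w => (h (f w) * e w)%:E) /\
    (\int[P]_w (h (f w) * e w)%:E = 0)%E.
  move=> mh h0 hle.
  have mhf : measurable_fun setT (h \o f) by exact: measurableT_comp.
  have ihe : P.-integrable setT (EFin \o ((h \o f) \* e)).
    apply: le_integrable ife => //.
      by apply/measurable_EFinP/measurable_funM.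
    by move=> w _ /=; rewrite lee_fin !normrM ler_wpM2r// ger0_norm.
  split => //; apply: (@integral_mul_ge0_eq0 (h \o f)) => //= B mB.
  rewrite comp_preimage; apply: fe0.
  by rewrite -[X in measurable X]setTI; exact: mh.
have [|||ip p0] := part (fun y => Num.max y 0).
- exact: measurable_maxr.
- by move=> y; rewrite le_max lexx orbT.
- by move=> y; rewrite ge_max ler_norm normr_ge0.
have [|||im m0] := part (fun y => Num.max (- y) 0).
- exact: measurable_maxr.
- by move=> y; rewrite le_max lexx orbT.
- by move=> y; rewrite ge_max -normrN ler_norm normr_ge0.
transitivity (\int[P]_w ((Num.max (f w) 0 * e w)%:E
                        - (Num.max (- f w) 0 * e w)%:E))%E.
  apply: eq_integral => w _; rewrite -EFinB -mulrBl; congr (_ * _)%:E.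
  have [f0|/ltW f0] := leP 0 (f w).
    by rewrite max_r ?oppr_le0// subr0.
  by rewrite max_l ?oppr_ge0// sub0r opprK.
by rewrite integralB// p0 m0 subee.
Qed.

(** An instance of [integral_mul_eq0] in which the roles are exchanged: the
    centred indicator of A integrates to 0 over every event of f. *)
Lemma integral_indep (A : set T) (f : T -> R) :
  measurable A -> P.-integrable setT (EFin \o f) ->
  (forall B, measurable B -> P (A `&` f @^-1` B) = P A * P (f @^-1` B))%E ->
  (\int[P]_(w in A) (f w)%:E = P A * \int[P]_w (f w)%:E)%E.
Proof.
move=> mA jf indep.
have mf : measurable_fun setT f by apply/measurable_EFinP/(measurable_int P).
have PA : P A \is a fin_num by exact: fin_num_measure.
pose c := fine (P A).
have restrE : (fun w => (f w * \1_A w)%:E) = (EFin \o f) \_ A.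
  apply/funext => w /=; rewrite patchE indicE.
  by case: (_ \in _); rewrite ?mulr1 ?mulr0.
have jA : P.-integrable setT (fun w => (f w * \1_A w)%:E).
  rewrite restrE; apply/(integrable_mkcond _ mA).
  exact: (integrableS measurableT).
have jc : P.-integrable setT (fun w => c%:E * (f w)%:E)%E.
  exact: integrableZl.
have fE w : (f w * (\1_A w - c))%:E
            = ((f w * \1_A w)%:E - c%:E * (f w)%:E)%E.
  by rewrite -EFinM -EFinB mulrBr [c * _]mulrC.
have j1 : P.-integrable setT (EFin \o (\1_A : T -> R)).
  exact: integrable_indic.
have := @integral_mul_eq0 f (\1_A \- cst c) mf.
rewrite /= (eq_integral _ _ (fun w _ => fE w)) integralB// integralZl//.
rewrite restrE -integral_mkcond fineK// => H.
have Af : (\int[P]_(w in A) (EFin \o f) w)%E \is a fin_num.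
  by apply: integrable_fin_num => //; exact: (integrableS measurableT).
have Tf : (\int[P]_w (EFin \o f) w)%E \is a fin_num.
  exact: integrable_fin_num.
have {H} : (\int[P]_(w in A) (EFin \o f) w
            - P A * \int[P]_w (EFin \o f) w = 0)%E.
  apply: H.
  - rewrite (_ : EFin \o _ = (EFin \o (\1_A : T -> R)) \- cst c%:E)%E//.
    by apply: integrableB => //; exact: finite_measure_integrable_cst.
  - rewrite (_ : EFin \o _ = fun w =>
      ((f w * \1_A w)%:E - c%:E * (f w)%:E)%E); last exact/funext.
    exact: integrableB.
  - move=> B mB; have mfB : measurable (f @^-1` B).
      by rewrite -[X in measurable X]setTI; exact: mf.
    under eq_integral do rewrite EFinB.
    rewrite integralB//; last 2 first.
    + exact: (integrableS measurableT).
    + apply: (integrableS measurableT) => //.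
      exact: finite_measure_integrable_cst.
    rewrite integral_indic// integral_cst// [X in (X - _)%E](indep B mB).
    rewrite fineK// subee//.
    by rewrite fin_numM// fin_num_measure.
rewrite -(fineK Af) -(fineK Tf) -(fineK PA) -EFinM -EFinB => -[/eqP].
by rewrite subr_eq0 => /eqP ->.
Qed.

End orthogonality.

(** * The noise given the past of the state *)

Section past.
Context d (T : measurableType d) (R : realType) (P : probability T R).
Variables (x0 : {RV P >-> R}) (eps : nat -> {RV P >-> R}).

Definition process_gen n : set (set T) :=
  \big[setU/set0]_(i < n) preimage_set_system setT (eps i : T -> R) measurable.

(** Intersections are taken so that the family is a pi-system; it generates the
    sigma-algebra of x0, eps_0, ..., eps_k. *)
Definition past_gen k : set (set T) :=
  [set A `&` B | A in preimage_set_system setT x0 measurable &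
                 B in <<s process_gen k.+1 >>].

Lemma process_gen_sub n (D : set (set T)) :
  (forall i, (i < n)%N -> forall Y, measurable Y -> D (eps i @^-1` Y)) ->
  process_gen n `<=` D.
Proof.
rewrite /process_gen; elim: n => [|n IH] De; first by rewrite big_ord0.
rewrite big_ord_recr /=; rewrite subUset; split.
  by apply: IH => i ni; exact/De/ltnW.
by move=> _ [Y mY <-]; rewrite setTI; exact: De.
Qed.

Lemma process_gen_eps n i : (i < n)%N -> forall Y, measurable Y ->
  process_gen n (eps i @^-1` Y).
Proof.
rewrite /process_gen => + Y mY; elim: n => // n IH.
rewrite ltnS leq_eqVlt big_ord_recr /= => /orP[/eqP ->|/IH]; last by left.
by right; exists Y => //; rewrite setTI.
Qed.

Lemma measurable_fun_process n i : (i < n)%N ->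
  measurable_fun [set: g_sigma_algebraType (process_gen n)] (eps i).
Proof.
move=> ni _ Y mY; rewrite setTI.
by apply: sub_sigma_algebra; exact: process_gen_eps.
Qed.

Lemma process_measurable n B : <<s process_gen n >> B -> measurable B.
Proof.
apply: smallest_sub; first exact: sigma_algebra_measurable.
apply: process_gen_sub => i _ Y mY.
by rewrite -[X in measurable X]setTI; exact: measurable_funP.
Qed.

Lemma process_le m n : (m <= n)%N ->
  <<s process_gen m >> `<=` <<s process_gen n >>.
Proof.
move=> mn; apply: smallest_sub; first exact: smallest_sigma_algebra.
apply: process_gen_sub => i im Y mY.
by apply: sub_sigma_algebra; apply: process_gen_eps => //; exact: leq_trans mn.
Qed.

Lemma past_genI k : setI_closed (past_gen k).
Proof.
move=> _ _ [_ [X mX <-] [B sB <-]] [_ [Y mY <-] [C sC <-]].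
exists (x0 @^-1` (X `&` Y)).
  by exists (X `&` Y); [exact: measurableI|rewrite setTI].
exists (B `&` C); first exact: (@measurableI _ (g_sigma_algebraType _)).
by rewrite !setTI preimage_setI setIACA.
Qed.

Lemma past_measurable k A : <<s past_gen k >> A -> measurable A.
Proof.
apply: smallest_sub; first exact: sigma_algebra_measurable.
move=> _ [_ [X mX <-] [B sB <-]]; apply: measurableI.
  exact: measurable_funP.
exact: process_measurable sB.
Qed.

Lemma measurable_fun_past_x0 k :
  measurable_fun [set: g_sigma_algebraType (past_gen k)] x0.
Proof.
move=> _ Y mY; rewrite setTI; apply: sub_sigma_algebra.
exists (x0 @^-1` Y); first by exists Y => //; rewrite setTI.
exists setT; last by rewrite setIT.
exact: (@measurableT _ (g_sigma_algebraType _)).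
Qed.

Lemma measurable_fun_past_eps k i : (i <= k)%N ->
  measurable_fun [set: g_sigma_algebraType (past_gen k)] (eps i).
Proof.
move=> ik _ Y mY; rewrite setTI; apply: sub_sigma_algebra.
exists setT; first by exists setT => //; rewrite setTI preimage_setT.
exists (eps i @^-1` Y); last by rewrite setTI.
by apply: sub_sigma_algebra; exact: process_gen_eps.
Qed.

(** Only eps_1, ..., eps_j enter the state at time j, and a feedback law is a
    deterministic function of the state once the law of the state is fixed. *)
Lemma measurable_fun_past_state (a b : nat -> R) (phi : policy R) k j :
  (j <= k)%N ->
  measurable_fun [set: g_sigma_algebraType (past_gen k)]
    (state a b x0 eps phi j).
Proof.
elim: j => [_|j IH jk]; first exact: measurable_fun_past_x0.
have mx := IH (ltnW jk).
apply: measurable_funD; last exact: measurable_fun_past_eps.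
apply: measurable_funD; apply: measurable_funM => //.
exact: measurableT_comp.
Qed.

Variables (N : nat).
Hypothesis (eps_int : forall k, (k <= N)%N ->
  P.-integrable setT (EFin \o eps k)).
Hypothesis (past0 : zero_mean_given_past N eps).
Hypothesis (indep : independent_of_process N x0 eps).

(** On A1 `&` B the integral of eps_{k+1} is that of eps_{k+1} \1_B, a function of
    the process, over an event A1 of x0; independence factors out P A1 and leaves
    the integral over B, an event of the past of the noise. *)
Lemma integral_past_gen k A : (k < N)%N -> past_gen k A ->
  (\int[P]_(w in A) (eps k.+1 w)%:E = 0)%E.
Proof.
move=> kN [A1 A1x [B sB <-{A}]].
have mA1 : measurable A1 by case: A1x => X mX <-; exact: measurable_funP.
have mB := process_measurable sB.
have ie := eps_int kN.
have mprod : measurable_fun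
    [set: g_sigma_algebraType (process_gen N.+1)] (eps k.+1 \* \1_B).
  apply: measurable_funM; first exact: measurable_fun_process.
  apply: (@measurable_indic _ (g_sigma_algebraType _)).
  by apply: process_le sB; exact: ltnW.
have restrE : EFin \o (eps k.+1 \* \1_B) = (EFin \o eps k.+1) \_ B.
  apply/funext => w /=; rewrite patchE indicE.
  by case: (_ \in _); rewrite ?mulr1 ?mulr0.
rewrite -/(comp EFin (eps k.+1)) integral_mkcondr -restrE.
rewrite integral_indep//.
- rewrite -[X in (_ * X)%E]/(\int[P]_w ((EFin \o (eps k.+1 \* \1_B)%R) w))%E.
  by rewrite restrE -integral_mkcond [X in (_ * X)%E]past0 ?mule0.
- rewrite restrE; apply/(integrable_mkcond _ mB).
  exact: (integrableS measurableT).
- move=> C mC; apply: indep => //; rewrite -[X in _ X]setTI; exact: mprod.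
Qed.

(** The events over which eps_{k+1} integrates to 0 form a lambda-system. *)
Lemma integral_past k A : (k < N)%N -> <<s past_gen k >> A ->
  (\int[P]_(w in A) (eps k.+1 w)%:E = 0)%E.
Proof.
move=> kN; have ie := eps_int kN.
suff : <<s past_gen k >> `<=`
    [set A | measurable A /\ (\int[P]_(w in A) (eps k.+1 w)%:E = 0)%E].
  by move=> /[apply] -[].
have eT : (\int[P]_w (eps k.+1 w)%:E = 0)%E.
  apply: integral_past_gen => //.
  exists setT; first by exists setT => //; rewrite setTI preimage_setT.
  exists setT; last by rewrite setIT.
  exact: (@measurableT _ (g_sigma_algebraType _)).
apply: lambda_system_subset => //; first exact: past_genI.
  apply/dynkin_lambda_system; split => //.
  - move=> C [mC C0]; split; first exact: measurableC.
    have := eT; rewrite -(setUv C) integral_setU//.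
    + by rewrite C0 add0e.
    + exact: measurableC.
    + by rewrite setUv; exact: measurable_int ie.
    + by apply/disj_setPCl.
  - move=> F tF F0; split; first by apply: bigcupT_measurable => i; case: (F0 i).
    rewrite integral_bigcup//.
    + by rewrite eseries0// => i _ _; case: (F0 i).
    + by move=> i; case: (F0 i).
    + apply: (integrableS measurableT) => //.
      by apply: bigcupT_measurable => i; case: (F0 i).
move=> C gC; split; last exact: integral_past_gen.
by apply: (@past_measurable k); exact: sub_sigma_algebra.
Qed.

End past.

(** * Moments of square integrable variables *)

Section moments.
Context d (T : measurableType d) (R : realType) (P : probability T R).
Local Open Scope ereal_scope.
Implicit Types X Y : T -> R.

Lemma Lfun_add (p : R) X Y : (1 <= p)%R ->
  X \in Lfun P p%:E -> Y \in Lfun P p%:E -> (X \+ Y)%R \in Lfun P p%:E.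
Proof. by move=> p1 Xp Yp; rewrite rpredD ?lee_fin. Qed.

Lemma Lfun2_sqr X : measurable_fun setT X ->
  'E_P[fun w => (X w ^+ 2)%R] < +oo -> X \in Lfun P 2%:E.
Proof.
move=> mX; rewrite unlock => X2.
rewrite inE; apply/andP; split; rewrite inE//=.
rewrite /finite_norm unlock poweR_lty//.
rewrite (eq_integral (fun w => (X w ^+ 2)%:E))// => w _ /=.
by rewrite powR_mulrn// real_normK ?num_real.
Qed.

Lemma Lfun_Lfun1 (p : R) X : (1 <= p)%R ->
  X \in Lfun P p%:E -> X \in Lfun P 1.
Proof.
by move=> p1; apply: Lfun_subset => //; exact: fin_num_measure.
Qed.

Lemma Lfun2_Lfun1 X : X \in Lfun P 2%:E -> X \in Lfun P 1.
Proof. by apply: Lfun_Lfun1; rewrite ler1n. Qed.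

(** The variance is the integral of a nonnegative function even when X is not
    square integrable, so its finiteness carries information. *)
Lemma Lfun2_variance X : measurable_fun setT X ->
  'V_P[X] < +oo -> X \in Lfun P 2%:E.
Proof.
move=> mX VX; pose c := fine 'E_P[X].
have Xc : (X \- cst c)%R \in Lfun P 2%:E.
  apply: Lfun2_sqr; first exact: measurable_funB.
  apply: le_lt_trans VX; rewrite /variance covariance.unlock.
  by rewrite le_eqVlt -/c; apply/orP; left; apply/eqP; congr expectation.
have -> : X = ((X \- cst c) \+ cst c)%R by apply/funext => w /=; rewrite subrK.
by apply: (Lfun_add (p := 2)) => //; [rewrite ler1n|exact: Lfun_cst].
Qed.

Lemma Lfun_lin (p : R) (a b : R) X Y : (1 <= p)%R ->
  X \in Lfun P p%:E -> Y \in Lfun P p%:E ->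
  ((a \o* X) \+ (b \o* Y))%R \in Lfun P p%:E.
Proof. by move=> p1 Xp Yp; rewrite Lfun_add ?Lfun_scale. Qed.

Lemma mean_lin (a b : R) X Y : X \in Lfun P 1 -> Y \in Lfun P 1 ->
  fine 'E_P[((a \o* X) \+ (b \o* Y))%R] =
  (a * fine 'E_P[X] + b * fine 'E_P[Y])%R.
Proof.
move=> X1 Y1; rewrite expectationD ?Lfun_scale// !expectationZl//.
by rewrite -(fineK (expectation_fin_num X1)) -(fineK (expectation_fin_num Y1)).
Qed.

Lemma variance_lin (a b : R) X Y :
  X \in Lfun P 2%:E -> Y \in Lfun P 2%:E ->
  fine 'V_P[((a \o* X) \+ (b \o* Y))%R] =
  (a ^+ 2 * fine 'V_P[X] + 2 * (a * b * fine (covariance P X Y))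
   + b ^+ 2 * fine 'V_P[Y])%R.
Proof.
move=> X2 Y2; have X1 := Lfun2_Lfun1 X2; have Y1 := Lfun2_Lfun1 Y2.
have XY := Lfun2_mul_Lfun1 X2 Y2.
have bY : (b \o* Y)%R \in Lfun P 2%:E by rewrite Lfun_scale ?ler1n.
have -> : 'V_P[((a \o* X) \+ (b \o* Y))%R] = 'V_P[(a \o* X)%R] +
    'V_P[(b \o* Y)%R] + 2%:E * covariance P (a \o* X) (b \o* Y).
  by rewrite varianceD// Lfun_scale ?ler1n.
rewrite covarianceZl//; last 2 first.
- exact: Lfun2_Lfun1.
- exact: Lfun2_mul_Lfun1.
rewrite covarianceZr// !varianceZ//.
rewrite -(fineK (variance_fin_num X2)) -(fineK (variance_fin_num Y2)).
rewrite -(fineK (covariance_fin_num X1 Y1 XY)).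
rewrite -!EFinM -!EFinD /=; ring.
Qed.

Lemma variance_lin_ge0 X Y : X \in Lfun P 2%:E -> Y \in Lfun P 2%:E ->
  forall t : R, (0 <= fine 'V_P[Y] + 2 * t * fine (covariance P X Y)
                       + t ^+ 2 * fine 'V_P[X])%R.
Proof.
move=> X2 Y2 t.
have := fine_ge0 (variance_ge0 P ((t \o* X) \+ (1 \o* Y))%R).
rewrite variance_lin//; congr (0 <= _)%R; ring.
Qed.

End moments.

(** * Evolution of the mean and of the variance of the state *)

Section dynamics.
Context d (T : measurableType d) (R : realType) (P : probability T R).
Variables (N : nat) (a b : nat -> R).
Variables (x0 : {RV P >-> R}) (eps : nat -> {RV P >-> R}).

Section closure.
Variables (phi : policy R) (p : R).
Hypotheses (p1 : 1 <= p) (x0p : (x0 : T -> R) \in Lfun P p%:E)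
  (epsp : forall k, (k <= N)%N -> (eps k : T -> R) \in Lfun P p%:E).

Lemma Lfun_stateS k : (k < N)%N ->
  (state a b x0 eps phi k : T -> R) \in Lfun P p%:E ->
  (control a b x0 eps phi k : T -> R) \in Lfun P p%:E ->
  (state a b x0 eps phi k.+1 : T -> R) \in Lfun P p%:E.
Proof.
by move=> kN xp up; apply: Lfun_add; [|exact: Lfun_lin|exact: epsp].
Qed.

Lemma Lfun_state k :
  (forall j, (j < N)%N ->
    (control a b x0 eps phi j : T -> R) \in Lfun P p%:E) ->
  (k <= N)%N -> (state a b x0 eps phi k : T -> R) \in Lfun P p%:E.
Proof.
move=> up; elim: k => // k IH kN.
by apply: Lfun_stateS => //; [exact: IH (ltnW kN)|exact: up].
Qed.

End closure.

Section moments_along.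
Variable phi : policy R.
Local Notation x := (state a b x0 eps phi).
Local Notation u := (control a b x0 eps phi).

Definition xmean k : R := fine 'E_P[x k]%E.
Definition umean k : R := fine 'E_P[u k]%E.
Definition xvar k : R := fine 'V_P[x k]%E.
Definition uvar k : R := fine 'V_P[u k]%E.
Definition xucov k : R := fine (covariance P (x k) (u k)).

Hypotheses
  (eps2 : forall k, (k <= N)%N -> (eps k : T -> R) \in Lfun P 2%:E)
  (eps_mean : forall k, (k <= N)%N -> ('E_P[eps k] = 0)%E)
  (past0 : zero_mean_given_past N eps)
  (indep : independent_of_process N x0 eps).
Variable (k : nat).
Hypotheses (kN : (k < N)%N) (x2 : (x k : T -> R) \in Lfun P 2%:E)
  (u2 : (u k : T -> R) \in Lfun P 2%:E).

Lemma xmeanS : xmean k.+1 = a k * xmean k + b k * umean k.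
Proof.
have x1 := Lfun2_Lfun1 x2; have u1 := Lfun2_Lfun1 u2.
rewrite /xmean [X in fine 'E_P[X]%E](_ : _ =
  ((a k \o* x k) \+ (b k \o* u k)) \+ eps k.+1)//.
rewrite expectationD ?Lfun_lin//; last exact/Lfun2_Lfun1/eps2.
by rewrite eps_mean// adde0 mean_lin.
Qed.

Lemma covariance_noise :
  (covariance P ((a k \o* x k) \+ (b k \o* u k)) (eps k.+1) = 0)%E.
Proof.
have f2 : ((a k \o* x k) \+ (b k \o* u k)) \in Lfun P 2%:E.
  by apply: Lfun_lin => //; rewrite ler1n.
have f1 := Lfun2_Lfun1 f2.
have e2 := eps2 kN; have e1 := Lfun2_Lfun1 e2.
have fe1 := Lfun2_mul_Lfun1 f2 e2.
rewrite covarianceE// eps_mean// mule0 sube0 unlock.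
apply: integral_mul_eq0.
- by apply: measurable_funD; apply: measurable_funM => //.
- exact/Lfun1_integrable.
- exact/Lfun1_integrable.
move=> B mB; apply: (@integral_past _ _ _ _ x0 _ N) => //.
  by move=> j jN; apply/Lfun1_integrable/Lfun2_Lfun1/eps2.
have mx := @measurable_fun_past_state _ _ _ _ x0 eps a b phi k k (leqnn k).
have mf : measurable_fun [set: g_sigma_algebraType (past_gen x0 eps k)]
    ((a k \o* x k) \+ (b k \o* u k)).
  by apply: measurable_funD; apply: measurable_funM => //;
    exact: measurableT_comp.
by rewrite -[X in <<s _ >> X]setTI; exact: mf.
Qed.

(** The cross term with the noise is the covariance that [covariance_noise]
    cancels. *)
Lemma xvarS : xvar k.+1 =
  a k ^+ 2 * xvar k + 2 * (a k * b k * xucov k) + b k ^+ 2 * uvar k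
  + fine 'E_P[fun w => (eps k.+1 w ^+ 2)%R]%E.
Proof.
have f2 : ((a k \o* x k) \+ (b k \o* u k)) \in Lfun P 2%:E.
  by apply: Lfun_lin => //; rewrite ler1n.
have e2 := eps2 kN.
rewrite /xvar [X in fine 'V_P[X]%E](_ : _ =
  ((a k \o* x k) \+ (b k \o* u k)) \+ eps k.+1)//.
rewrite varianceD// covariance_noise mule0 adde0.
rewrite fineD ?variance_fin_num// variance_lin//; congr (_ + fine _).
by rewrite varianceE// eps_mean// expe2 mule0 sube0.
Qed.

End moments_along.

End dynamics.

Definition affine (R : realType) (c e : R) (y : R) : R := y * c + e.

Lemma measurable_affine (R : realType) (c e : R) :
  measurable_fun setT (affine c e).
Proof. by apply: measurable_funD => //; exact: measurable_funM. Qed.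

HB.instance Definition _ (R : realType) (c e : R) :=
  isMeasurableFun.Build _ _ _ _ (affine c e) (measurable_affine c e).

(** * Verification by the value function *)

Section verification.
Context d (T : measurableType d) (R : realType) (P : probability T R).
Variables (N : nat) (a b q r qbar rbar : nat -> R).
Variables (x0 : {RV P >-> R}) (eps : nat -> {RV P >-> R}).
Hypotheses
  (hq : forall k, (k <= N)%N -> 0 < q k)
  (hqbar : forall k, (k <= N)%N -> 0 < qbar k)
  (hr : forall k, (k < N)%N -> 0 < r k)
  (hrbar : forall k, (k < N)%N -> 0 < rbar k).
Hypotheses
  (eps2 : forall k, (k <= N)%N -> (eps k : T -> R) \in Lfun P 2%:E)
  (eps_mean : forall k, (k <= N)%N -> ('E_P[eps k] = 0)%E)
  (past0 : zero_mean_given_past N eps)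
  (indep : independent_of_process N x0 eps).

Local Notation X phi := (state a b x0 eps phi).
Local Notation U phi := (control a b x0 eps phi).
Local Notation xm phi := (xmean a b x0 eps phi).
Local Notation um phi := (umean a b x0 eps phi).
Local Notation xv phi := (xvar a b x0 eps phi).
Local Notation uv phi := (uvar a b x0 eps phi).

Definition stage_cost phi k : R :=
  q k * xv phi k + qbar k * xm phi k ^+ 4
  + r k * uv phi k + rbar k * um phi k ^+ 4.

Definition square_integrable phi : Prop :=
  (forall k, (k <= N)%N -> (X phi k : T -> R) \in Lfun P 2%:E) /\
  (forall k, (k < N)%N -> (U phi k : T -> R) \in Lfun P 2%:E).

Lemma cost_square_integrable phi : square_integrable phi ->
  cost N a b q r qbar rbar x0 eps phi =
  (q N * xv phi N + qbar N * xm phi N ^+ 4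
   + \sum_(k < N) stage_cost phi k)%:E.
Proof.
move=> [x2 u2].
have xE k : (k <= N)%N -> 'E_P[X phi k]%E = (xm phi k)%:E.
  by move=> kN; rewrite /xmean fineK//; exact/expectation_fin_num/Lfun2_Lfun1/x2.
have uE k : (k < N)%N -> 'E_P[U phi k]%E = (um phi k)%:E.
  by move=> kN; rewrite /umean fineK//; exact/expectation_fin_num/Lfun2_Lfun1/u2.
have xV k : (k <= N)%N -> 'V_P[X phi k]%E = (xv phi k)%:E.
  by move=> kN; rewrite /xvar fineK//; exact/variance_fin_num/x2.
have uV k : (k < N)%N -> 'V_P[U phi k]%E = (uv phi k)%:E.
  by move=> kN; rewrite /uvar fineK//; exact/variance_fin_num/u2.
rewrite /cost (eq_bigr (fun k : 'I_N => (stage_cost phi k)%:E)) => [|k _].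
  by rewrite sumEFin xE// xV// -EFin_expe -!EFinM -!EFinD.
have kN := ltn_ord k; have kN' := ltnW kN.
by rewrite xE// uE// xV// uV// -!EFin_expe -!EFinM -!EFinD.
Qed.

(** All terms of the cost are nonnegative and the weights of the variances are
    positive, so a single infinite variance makes the cost infinite. *)
Lemma square_integrable_of_cost_lty phi : (x0 : T -> R) \in Lfun P 1 ->
  admissible N a b x0 eps phi ->
  (cost N a b q r qbar rbar x0 eps phi < +oo)%E -> square_integrable phi.
Proof.
move=> x01 adm.
have u1 k : (k < N)%N -> (U phi k : T -> R) \in Lfun P 1.
  by move=> kN; apply/Lfun1_integrable; exact: adm.
have x1 k : (k <= N)%N -> (X phi k : T -> R) \in Lfun P 1.
  move=> kN; apply: (@Lfun_state _ _ _ _ N _ _ _ _ _ 1) => // j jN.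
  exact/Lfun2_Lfun1/eps2.
have E4 (Y : T -> R) (c : R) : 0 < c -> Y \in Lfun P 1 ->
    (0 <= c%:E * 'E_P[Y] ^+ 4)%E.
  move=> c0 Y1; rewrite -(fineK (expectation_fin_num Y1)) -EFin_expe -EFinM.
  by rewrite lee_fin mulr_ge0 ?exprn_even_ge0// ltW.
have V0 (Y : T -> R) (c : R) : 0 < c -> (0 <= c%:E * 'V_P[Y])%E.
  by move=> c0; rewrite mule_ge0 ?variance_ge0// lee_fin ltW.
have Vlty (Y : {mfun T >-> R}) (c : R) : 0 < c ->
    (c%:E * 'V_P[Y] < +oo)%E -> (Y : T -> R) \in Lfun P 2%:E.
  move=> c0 VY; apply: Lfun2_variance => //.
  move: VY; have := variance_ge0 P Y; case: ('V_P[Y])%E => [v| |]//.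
    by move=> _ _; exact: ltry.
  by move=> _; rewrite gt0_muley ?lte_fin// ltxx.
rewrite /cost; set A := (X in (X + _ < _)%E).
set B := (X in (A + X < _)%E) => AB.
have A0 : (0 <= A)%E by rewrite adde_ge0 ?V0 ?E4 ?hq ?hqbar// x1.
have term0 (k : 'I_N) : ((0 <= (q k)%:E * 'V_P[X phi k]) /\
    (0 <= (qbar k)%:E * 'E_P[X phi k] ^+ 4) /\
    (0 <= (r k)%:E * 'V_P[U phi k]) /\
    (0 <= (rbar k)%:E * 'E_P[U phi k] ^+ 4))%E.
  have kN := ltn_ord k; have kN' := ltnW kN.
  by rewrite !V0 ?hq ?hr// !E4 ?hqbar ?hrbar ?x1 ?u1.
have B0 : (0 <= B)%E.
  by apply: sume_ge0 => k _; case: (term0 k) => ? [? [? ?]]; rewrite !adde_ge0.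
have Alty : (A < +oo)%E by apply: le_lt_trans AB; rewrite leeDl.
have Blty : (B < +oo)%E by apply: le_lt_trans AB; rewrite leeDr.
have termlty (k : 'I_N) : (((q k)%:E * 'V_P[X phi k] < +oo) /\
    ((r k)%:E * 'V_P[U phi k] < +oo))%E.
  have [t1 [t2 [t3 t4]]] := term0 k.
  have tlty : ((q k)%:E * 'V_P[X phi k] + (qbar k)%:E * 'E_P[X phi k] ^+ 4 +
      (r k)%:E * 'V_P[U phi k] + (rbar k)%:E * 'E_P[U phi k] ^+ 4 < +oo)%E.
    apply: le_lt_trans Blty; rewrite /B (bigD1 k)//= leeDl// sume_ge0// => j _.
    by case: (term0 j) => ? [? [? ?]]; rewrite !adde_ge0.
  split; apply: le_lt_trans tlty.
    by rewrite -!addeA leeDl// !adde_ge0.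
  by rewrite addeAC leeDr// !adde_ge0.
split=> k; last first.
  move=> kN; apply: (Vlty (U phi k) (r k)); first exact: hr.
  exact: (termlty (Ordinal kN)).2.
rewrite leq_eqVlt => /orP[/eqP ->|kN]; last first.
  apply: (Vlty (X phi k) (q k)); first exact/hq/ltnW.
  exact: (termlty (Ordinal kN)).1.
apply: (Vlty (X phi N) (q N)); first exact: hq.
by apply: le_lt_trans Alty; rewrite leeDl// E4 ?hqbar ?x1.
Qed.

Variables (alpha alphabar gammabar : nat -> R).

Definition gain k : R :=
  (alpha k.+1 * b k * a k) / (r k + alpha k.+1 * b k ^+ 2).
Definition mean_gain k : R :=
  (cbrt (alphabar k.+1 * b k / rbar k) * a k)
    / (1 + cbrt (alphabar k.+1 * b k / rbar k) * b k).

Hypotheses (halphabarN : alphabar N = qbar N) (hgammabarN : gammabar N = 0)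
  (halphaN : alpha N = q N).
Hypothesis halphabar : forall k, (k < N)%N ->
     alphabar k = qbar k
       + rbar k * mean_gain k ^+ 4
       + alphabar k.+1 *
           (a k - (cbrt (alphabar k.+1 * b k / rbar k) * a k * b k)
                  / (1 + cbrt (alphabar k.+1 * b k / rbar k) * b k)) ^+ 4.
Hypothesis hgammabar : forall k, (k < N)%N ->
     gammabar k = gammabar k.+1
       + alpha k.+1 * fine 'E_P[fun w => (eps k.+1 w ^+ 2)%R]%E.
Hypothesis halpha : forall k, (k < N)%N ->
     alpha k = q k
       + r k * gain k ^+ 2
       + alpha k.+1 *
           (a k - (alpha k.+1 * b k ^+ 2 * a k)
                  / (r k + alpha k.+1 * b k ^+ 2)) ^+ 2.

Lemma backward_ind (Q : nat -> Prop) : Q N ->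
  (forall k, (k < N)%N -> Q k.+1 -> Q k) -> forall k, (k <= N)%N -> Q k.
Proof.
move=> QN QS k kN; rewrite -(subKn kN); elim: (N - k)%N (leq_subr k N) => [|j IH].
  by rewrite subn0.
move=> jN; apply: QS; first by rewrite ltn_subrL/= (leq_trans _ jN).
by rewrite -subSn// subSS; apply: IH; exact: ltnW.
Qed.

Lemma alpha_gt0 k : (k <= N)%N -> 0 < alpha k.
Proof.
move: k; apply: backward_ind => [|k kN ak]; first by rewrite halphaN hq.
rewrite halpha// -addrA; apply: ltr_pwDl; first exact/hq/ltnW.
by apply: addr_ge0; apply: mulr_ge0; rewrite ?sqr_ge0// ltW// hr.
Qed.

Lemma alphabar_gt0 k : (k <= N)%N -> 0 < alphabar k.
Proof.
move: k; apply: backward_ind => [|k kN ak]; first by rewrite halphabarN hqbar.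
rewrite halphabar// -addrA; apply: ltr_pwDl; first exact/hqbar/ltnW.
by apply: addr_ge0; apply: mulr_ge0; rewrite ?exprn_even_ge0// ltW// hrbar.
Qed.

Definition value phi k : R :=
  alpha k * xv phi k + alphabar k * xm phi k ^+ 4 + gammabar k.

(** The loss of phi at stage k with respect to the dynamic programming
    equation. *)
Definition gap phi k : R :=
  stage_cost phi k + value phi k.+1 - value phi k.

(** The terminal cost is the value function at time N, so the sum of the values
    telescopes down to the initial one. *)
Lemma cost_gap phi : square_integrable phi ->
  cost N a b q r qbar rbar x0 eps phi =
  (value phi 0 + \sum_(k < N) gap phi k)%:E.
Proof.
move=> phi2; rewrite cost_square_integrable//; congr EFin.
have -> : \sum_(k < N) gap phi k =
    \sum_(k < N) stage_cost phi k + (value phi N - value phi 0).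
  rewrite -(telescope_sumr (value phi) (leq0n N)) big_mkord -big_split/=.
  by apply: eq_bigr => k _; rewrite addrA.
rewrite [value phi N]/value halphaN halphabarN hgammabarN; ring.
Qed.

(** The recursion for gammabar absorbs the variance of the noise, the only term
    that the control cannot influence; the rest separates into variance and
    mean. *)
Lemma gapE phi k : square_integrable phi -> (k < N)%N ->
  let v := xv phi k in let w := uv phi k in
  let z := xucov a b x0 eps phi k in
  let m := xm phi k in let n := um phi k in
  gap phi k =
  (r k * w + alpha k.+1 * (a k ^+ 2 * v + 2 * (a k * b k * z) + b k ^+ 2 * w)
   - (alpha k - q k) * v) +
  (rbar k * n ^+ 4 + alphabar k.+1 * (a k * m + b k * n) ^+ 4
   - (alphabar k - qbar k) * m ^+ 4).
Proof.
move=> [x2 u2] kN /=; rewrite /gap /stage_cost /value.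
rewrite (xmeanS eps2 eps_mean)//; [|exact/x2/ltnW|exact: u2].
rewrite (xvarS eps2 eps_mean past0 indep)//; [|exact/x2/ltnW|exact: u2].
rewrite (hgammabar kN); ring.
Qed.

Lemma gap_ge0 phi k : square_integrable phi -> (k < N)%N -> 0 <= gap phi k.
Proof.
move=> phi2 kN; rewrite gapE//; have [x2 u2] := phi2.
rewrite addr_ge0// subr_ge0.
  rewrite (halpha kN) -[q k + _ + _]addrA [q k + (_ + _)]addrC addrK.
  apply: variance_stage; [exact: alpha_gt0|exact: hr|].
  apply: variance_lin_ge0; [exact/x2/ltnW|exact: u2].
rewrite (halphabar kN) -[qbar k + _ + _]addrA [qbar k + (_ + _)]addrC addrK.
by apply: mean_stage; [exact: alphabar_gt0|exact: hrbar].
Qed.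

(** The mean of the state is recovered from its law, as the mean of the identity;
    the affine function is -K (y - m) - L m expanded in y, with K = [gain k] and
    L = [mean_gain k]. *)
Definition feedback_law : policy R := fun k mu =>
  let m := fine (\int[mu]_y y%:E)%E in
  affine (- gain k) ((gain k - mean_gain k) * m).

Lemma control_feedback_law k : (X feedback_law k : T -> R) \in Lfun P 1 ->
  U feedback_law k = ((- gain k) \o* X feedback_law k) \+
    (1 \o* cst ((gain k - mean_gain k) * xm feedback_law k)) :> (T -> R).
Proof.
move=> x1; apply/funext => w.
rewrite /control /feedback /= /affine /xmean expectation.unlock.
rewrite integral_distribution//; last exact/Lfun1_integrable.
by rewrite mulr1 mulrC.
Qed.

(** For p = 1 this is the admissibility of the feedback law; for p = 2 it puts
    the feedback law in the scope of [cost_gap] when x0 is square integrable. *)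
Lemma Lfun_feedback_law (p : R) : 1 <= p ->
  (x0 : T -> R) \in Lfun P p%:E ->
  (forall k, (k <= N)%N -> (eps k : T -> R) \in Lfun P p%:E) ->
  (forall k, (k <= N)%N -> (X feedback_law k : T -> R) \in Lfun P p%:E) /\
  (forall k, (k < N)%N -> (U feedback_law k : T -> R) \in Lfun P p%:E).
Proof.
move=> p1 x0p epsp.
have up k : (X feedback_law k : T -> R) \in Lfun P p%:E ->
    (U feedback_law k : T -> R) \in Lfun P p%:E.
  move=> xp; rewrite control_feedback_law; last exact: Lfun_Lfun1 xp.
  by apply: Lfun_lin => //; exact: Lfun_cst.
have xp k : (k <= N)%N -> (X feedback_law k : T -> R) \in Lfun P p%:E.
  elim: k => // k IH kN; have xk := IH (ltnW kN).
  by apply: Lfun_stateS kN _ _ => //; exact: up.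
by split=> // k kN; apply: up; exact/xp/ltnW.
Qed.

(** The control -K (x - m) - L m has mean - L m, variance K^2 v and covariance
    - K v with the state: these are the equality cases of both stage
    inequalities. *)
Lemma gap_feedback_law k : (k < N)%N ->
  square_integrable feedback_law -> gap feedback_law k = 0.
Proof.
move=> kN phi2; rewrite gapE//; have [/(_ _ (ltnW kN)) x2 _] := phi2.
have x1 := Lfun2_Lfun1 x2.
set m := xm feedback_law k.
have c2 : cst ((gain k - mean_gain k) * m) \in Lfun P 2%:E by exact: Lfun_cst.
have c1 := Lfun2_Lfun1 c2.
have uE := control_feedback_law x1.
have -> : um feedback_law k = - mean_gain k * m.
  rewrite /umean uE mean_lin// expectation_cst /= -/(xmean _ _ _ _ _ _) -/m.
  ring.
have -> : uv feedback_law k = gain k ^+ 2 * xv feedback_law k.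
  rewrite /uvar uE variance_lin// variance_cst covariance_cst_r /= /xvar.
  ring.
have -> : xucov a b x0 eps feedback_law k = - gain k * xv feedback_law k.
  rewrite /xucov uE covarianceDr//; last 2 first.
  - by rewrite Lfun_scale ?ler1n.
  - by rewrite Lfun_scale ?ler1n.
  have -> : 1 \o* cst ((gain k - mean_gain k) * m) =
      cst ((gain k - mean_gain k) * m) :> (T -> R).
    by apply/funext => w /=; rewrite mulr1.
  rewrite covariance_cst_r adde0 covarianceZr//; last exact: Lfun2_mul_Lfun1.
  by rewrite fineM ?variance_fin_num.
rewrite (halpha kN) (halphabar kN) /gain /mean_gain.
have D : 0 < r k + alpha k.+1 * b k ^+ 2.
  by rewrite ltr_wpDr ?hr// mulr_ge0 ?sqr_ge0// ltW// alpha_gt0.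
have Db := mean_gain_denom_gt0 (b k) (alphabar_gt0 kN) (hrbar kN).
by field; rewrite !gt_eqF.
Qed.

End verification.

Theorem proposition3 (R : realType) (d : measure_display)
  (T : measurableType d) (P : probability T R) (N : nat)
  (a b q r qbar rbar : nat -> R)
  (hq : forall k, (k <= N)%N -> 0 < q k)
  (hqbar : forall k, (k <= N)%N -> 0 < qbar k)
  (hr : forall k, (k < N)%N -> 0 < r k)
  (hrbar : forall k, (k < N)%N -> 0 < rbar k)
  (x0 : {RV P >-> R}) (eps : nat -> {RV P >-> R})
  (hx0 : P.-integrable setT (EFin \o x0))
  (heps0 : forall w, eps 0%N w = 0)
  (heps_mean : forall k, (k <= N)%N -> ('E_P[eps k] = 0)%E)
  (heps_sqr : forall k, (k <= N)%N ->
     ('E_P[fun w => (eps k w ^+ 2)%R] < +oo)%E)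
  (heps_past : zero_mean_given_past N eps)
  (hindep : independent_of_process N x0 eps)
  (alphabar gammabar alpha : nat -> R)
  (halphabarN : alphabar N = qbar N)
  (hgammabarN : gammabar N = 0)
  (halphaN : alpha N = q N)
  (halphabar : forall k, (k < N)%N ->
     alphabar k = qbar k
       + rbar k * ((cbrt (alphabar k.+1 * b k / rbar k) * a k)
                   / (1 + cbrt (alphabar k.+1 * b k / rbar k) * b k)) ^+ 4
       + alphabar k.+1 *
           (a k - (cbrt (alphabar k.+1 * b k / rbar k) * a k * b k)
                  / (1 + cbrt (alphabar k.+1 * b k / rbar k) * b k)) ^+ 4)
  (hgammabar : forall k, (k < N)%N ->
     gammabar k = gammabar k.+1
       + alpha k.+1 * fine 'E_P[fun w => (eps k.+1 w ^+ 2)%R]%E)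
  (halpha : forall k, (k < N)%N ->
     alpha k = q k
       + r k * ((alpha k.+1 * b k * a k) / (r k + alpha k.+1 * b k ^+ 2)) ^+ 2
       + alpha k.+1 *
           (a k - (alpha k.+1 * b k ^+ 2 * a k)
                  / (r k + alpha k.+1 * b k ^+ 2)) ^+ 2) :
  exists ustar : policy R,
    (forall (k : nat) (w : T), (k < N)%N ->
       let x := state a b x0 eps ustar k in
       let xbar := fine 'E_P[x]%E in
       control a b x0 eps ustar k w =
         - ((alpha k.+1 * b k * a k) / (r k + alpha k.+1 * b k ^+ 2))
             * (x w - xbar)
         - (cbrt (alphabar k.+1 * b k / rbar k) * a k)
             / (1 + cbrt (alphabar k.+1 * b k / rbar k) * b k) * xbar) /\
    optimal N a b q r qbar rbar x0 eps ustar.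
Proof.
have eps2 k : (k <= N)%N -> (eps k : T -> R) \in Lfun P 2%:E.
  by move=> kN; apply: Lfun2_sqr => //; exact: heps_sqr.
have x01 : (x0 : T -> R) \in Lfun P 1 by exact/Lfun1_integrable.
pose ustar := feedback_law a b r rbar alpha alphabar.
have [x1 u1] : (forall k, (k <= N)%N ->
      (state a b x0 eps ustar k : T -> R) \in Lfun P 1) /\
    (forall k, (k < N)%N -> (control a b x0 eps ustar k : T -> R) \in Lfun P 1).
  by apply: (@Lfun_feedback_law _ _ _ _ _ _ _ _ _ _ _ _ _ 1) => // k kN;
     exact/Lfun2_Lfun1/eps2.
exists ustar; split.
  move=> k w kN x xbar.
  have /(congr1 (fun u : T -> R => u w)) uE :=
    control_feedback_law (x1 k (ltnW kN)).
  rewrite [LHS]uE /= /xmean /xbar /x /gain /mean_gain; ring.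
split=> [k kN|psi adm]; first exact/Lfun1_integrable/u1.
(* A policy of infinite cost is never better; finite cost forces x0 to be square
   integrable, and only then is the cost of ustar computed. *)
have [->|fin] := eqVneq (cost N a b q r qbar rbar x0 eps psi) +oo%E.
  exact: leey.
have psi2 : square_integrable N a b x0 eps psi.
  by apply: (square_integrable_of_cost_lty hq hqbar hr hrbar) => //; rewrite ltey.
have ustar2 : square_integrable N a b x0 eps ustar.
  apply: (@Lfun_feedback_law _ _ _ _ _ _ _ _ _ _ _ _ _ 2) => //.
    by rewrite ler1n.
  exact: (psi2.1 0%N (leq0n N)).
rewrite !(cost_gap r rbar halphabarN hgammabarN halphaN)// lee_fin.
rewrite big1 => [|k _]; last first.
  exact: (gap_feedback_law hq hqbar hr hrbar eps2 heps_mean heps_past hindep).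
(* Both values at time 0 are computed from x0, whatever the policy. *)
rewrite addr0 [leLHS](_ : _ = value a b x0 eps alpha alphabar gammabar psi 0)//.
rewrite lerDl sumr_ge0// => k _.
exact: (gap_ge0 hq hqbar hr hrbar eps2 heps_mean heps_past hindep).
Qed.
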